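(* Let $(\mathcal{R},\leq,r)$ be a \textbf{wA2}-space such that $\mathcal{AR}$ is countable (so $\mathcal{R}$ is a Polish space under the first-difference metric). Then every analytic subset of $\mathcal{R}$ is Kastanas Ramsey.
   Context: $\mathcal{R}$ is a nonempty set, $\leq$ a quasi-order on $\mathcal{R}$, $\mathcal{AR}$ a set and $r:\mathcal{R}\times\omega\to\mathcal{AR}$; write $r_n(A):=r(A,n)$, $\mathcal{AR}_n:=\{r_n(A):A\in\mathcal{R}\}$. Axiom A1: (1) $r_0(A)=\emptyset$ for all $A$; (2) $A\neq B$ implies $r_n(A)\neq r_n(B)$ for some $n$; (3) $r_n(A)=r_m(B)$ implies $n=m$ and $r_k(A)=r_k(B)$ for $k<n$. $\mathrm{lh}(a)$ is the unique $n$ with $a\in\mathcal{AR}_n$; $a\sqsubseteq b$ means $a=r_m(A),b=r_n(A)$ for some $A$ and $m\le n$. Axiom wA2: a quasi-order $\leq_{\mathrm{fin}}$ on $\mathcal{AR}$ with (w1) $\{a:a\leq_{\mathrm{fin}}b\}$ countable for all $b$; (2) $A\le B$ iff $\forall n\exists m\,r_n(A)\leq_{\mathrm{fin}}r_m(B)$; (3) $a\sqsubseteq b$, $b\leq_{\mathrm{fin}}c$ imply $\exists d\sqsubseteq c$ with $a\leq_{\mathrm{fin}}d$. $[a,A]:=\{B\le A:\exists n\,r_n(B)=a\}$, $[n,A]:=[r_n(A),A]$, $\mathrm{depth}_B(a):=\min\{n:a\leq_{\mathrm{fin}}r_n(B)\}$ (or $\infty$), $\mathcal{AR}{\upharpoonright}A:=\{a:\exists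 n\,a\leq_{\mathrm{fin}}r_n(A)\}$, $r_n[a,A]:=\{b\in\mathcal{AR}{\upharpoonright}A:a\sqsubseteq b,\mathrm{lh}(b)=n\}$. Axiom A3: (1) if $\mathrm{depth}_B(a)<\infty$ then $[a,A]\ne\emptyset$ for all $A\in[\mathrm{depth}_B(a),B]$; (2) if $A\le B$ and $[a,A]\ne\emptyset$ there is $A'\in[\mathrm{depth}_B(a),B]$ with $\emptyset\ne[a,A']\subseteq[a,A]$. Identifying $A\in\mathcal{R}$ with $(r_n(A))_n\in\mathcal{AR}^{\mathbb N}$, a \textbf{wA2}-space is such a triple satisfying A1, wA2, A3 with $\mathcal{R}$ closed in $\mathcal{AR}^{\mathbb N}$ (product of discrete spaces). The topology used is that of the first-difference metric $d(A,B)=2^{-n}$, $n$ least with $r_n(A)\ne r_n(B)$. Kastanas game $K[a,A]$ ($a\in\mathcal{AR}{\upharpoonright}A$): with $a_0=a$, $B_{-1}=A$, in round $n$ player I plays $A_n\in[a_n,B_{n-1}]$, then II plays $a_{n+1}\in r_{\mathrm{lh}(a_n)+1}[a_n,A_n]$ and $B_n\in[a_{n+1},A_n]$; the outcome is the $B\in\mathcal{R}$ with $r_{\mathrm{lh}(a)+n}(B)=a_n$ for all $n$. $\mathcal{X}\subseteq\mathcal{R}$ is Kastanas Ramsey if for all $A$ and $a\in\mathcal{AR}{\upharpoonright}A$ there is $B\in[a,A]$ such that I has a strategy in $K[a,B]$ ensuring the outcome is in $\mathcal{X}^c$, or II has a strategy in $K[a,B]$ ensuring the outcome is in $\mathcal{X}$.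 *)

(* Defs.v *)
From HB Require Import structures.
From mathcomp Require Import all_boot all_order all_algebra.
From mathcomp Require Import all_classical all_reals all_analysis.

Set Implicit Arguments.
Unset Strict Implicit.
Unset Printing Implicit Defensive.

Import Order.TTheory GRing.Theory Num.Theory.

Local Open Scope classical_set_scope.

(* [None] when [P] is empty; it then stands for the value infinity. *)
Definition least (P : set nat) : option nat :=
  if pselect (exists n, `[< P n >]) is left h then Some (ex_minn h) else None.

(* A triple (R, <=, r) together with the quasi-order <=_fin of axiom wA2 and
   the element of AR written as the empty set in axiom A1. *)
Record approx_data := ApproxData {
  pts : Type;
  apx : Type;
  pt_le : pts -> pts -> Prop;
  restr : pts -> nat -> apx;
  apx_empty : apx;
  fin_le : apx -> apx -> Prop
}.

Section Notions.
Variable S : approx_data.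
Local Notation R := (pts S).
Local Notation AR := (apx S).
Local Notation "A <=' B" := (@pt_le S A B) (at level 70).
Local Notation "a <=fin b" := (@fin_le S a b) (at level 70).
Local Notation "r_[ n ] A" := (@restr S A n)
  (at level 10, A at level 8, format "r_[ n ]  A").

Definition apx_level (n : nat) : set AR := range (fun A : R => r_[n] A).

(* By A1, [n] with [apx_level n a] is unique when it exists; the value 0 is
   assigned to the elements of [AR] that approximate no point. *)
Definition lh (a : AR) : nat := xget 0%N [set n | apx_level n a].

Definition initial_seg (a b : AR) : Prop :=
  exists (A : R) (m n : nat), [/\ (m <= n)%N, a = r_[m] A & b = r_[n] A].

Definition basic (a : AR) (A : R) : set R :=
  [set B | B <=' A /\ exists n, r_[n] B = a].

Definition basic_at (n : nat) (A : R) : set R := basic (r_[n] A) A.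

Definition depth (B : R) (a : AR) : option nat :=
  least [set n | a <=fin r_[n] B].

Definition apx_below (A : R) : set AR := [set a | exists n, a <=fin r_[n] A].

Definition extensions (n : nat) (a : AR) (A : R) : set AR :=
  [set b | [/\ apx_below A b, initial_seg a b & lh b = n]].

Record axiom_A1 : Prop := BuildA1 {
  A1_empty : forall A : R, r_[0%N] A = apx_empty S;
  A1_separated : forall A B : R, A <> B -> exists n, r_[n] A <> r_[n] B;
  A1_coherent : forall (A B : R) (n m : nat), r_[n] A = r_[m] B ->
    n = m /\ forall k, (k < n)%N -> r_[k] A = r_[k] B
}.

Record axiom_wA2 : Prop := BuildWA2 {
  wA2_preorder : RelationClasses.PreOrder (@fin_le S);
  wA2_countable : forall b : AR, countable [set a | a <=fin b];
  wA2_le : forall A B : R,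
    A <=' B <-> forall n, exists m, r_[n] A <=fin r_[m] B;
  wA2_seg : forall a b c : AR, initial_seg a b -> b <=fin c ->
    exists2 d, initial_seg d c & a <=fin d
}.

Record axiom_A3 : Prop := BuildA3 {
  A3_nonempty : forall (B : R) (a : AR) (n : nat), depth B a = Some n ->
    forall A, basic_at n B A -> basic a A !=set0;
  A3_amalgamation : forall (A B : R) (a : AR),
    A <=' B -> basic a A !=set0 ->
    exists (n : nat) (A' : R), [/\ depth B a = Some n, basic_at n B A',
      basic a A' !=set0 & basic a A' `<=` basic a A]
}.

Definition approx_seq (A : R) : {ptws nat -> discrete_topology {classic AR}} :=
  fun n => r_[n] A.

Record wA2_axioms : Prop := BuildWA2Laws {
  pts_nonempty : [set: R] !=set0;
  pt_le_preorder : RelationClasses.PreOrder (@pt_le S);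
  wA2_axiom_A1 : axiom_A1;
  wA2_axiom_wA2 : axiom_wA2;
  wA2_axiom_A3 : axiom_A3;
  pts_closed : closed (range approx_seq)
}.

(* A run of the game K[a, A] is given by the sequences [as_] (with
   [as_ 0 = a]), [As] (moves of player I) and [Bs]; in round [n] player II
   plays the pair [(as_ n.+1, Bs n)]. *)
Definition previous (A : R) (Bs : nat -> R) (n : nat) : R :=
  if n is k.+1 then Bs k else A.

Definition legal_I (A : R) (as_ : nat -> AR) (As Bs : nat -> R) (n : nat) :
    Prop :=
  basic (as_ n) (previous A Bs n) (As n).

Definition legal_II (as_ : nat -> AR) (As Bs : nat -> R) (n : nat) : Prop :=
  extensions (lh (as_ n)).+1 (as_ n) (As n) (as_ n.+1) /\
  basic (as_ n.+1) (As n) (Bs n).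

Definition is_outcome (a : AR) (as_ : nat -> AR) (B : R) : Prop :=
  forall n, r_[(lh a + n)%N] B = as_ n.

(* A strategy maps the list of the opponent's previous moves to the next move.
   Its moves must be legal as long as the opponent's earlier moves are; this is
   required round by round, since a position reached by an illegal move need
   not extend to an infinite run. *)
Definition I_can_ensure (a : AR) (A : R) (X : set R) : Prop :=
  exists sigma : seq (AR * R) -> R,
  forall (as_ : nat -> AR) (Bs : nat -> R), as_ 0%N = a ->
  let As n := sigma (mkseq (fun i => (as_ i.+1, Bs i)) n) in
  (forall n, (forall i, (i < n)%N -> legal_II as_ As Bs i) ->
     legal_I A as_ As Bs n) /\
  ((forall n, legal_II as_ As Bs n) ->
     exists2 B, is_outcome a as_ B & X B).

Definition II_can_ensure (a : AR) (A : R) (X : set R) : Prop :=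
  exists tau : seq R -> AR * R,
  forall As : nat -> R,
  let as_ n := if n is k.+1 then (tau (mkseq As k.+1)).1 else a in
  let Bs n := (tau (mkseq As n.+1)).2 in
  (forall n, (forall i, (i <= n)%N -> legal_I A as_ As Bs i) ->
     legal_II as_ As Bs n) /\
  ((forall n, legal_I A as_ As Bs n) ->
     exists2 B, is_outcome a as_ B & X B).

Definition kastanas_ramsey (X : set R) : Prop :=
  forall (A : R) (a : AR), apx_below A a ->
  exists2 B, basic a A B & I_can_ensure a B (~` X) \/ II_can_ensure a B X.

End Notions.

Record wA2_space := WA2Space {
  wA2_data :> approx_data;
  wA2_spaceP : wA2_axioms wA2_data
}.

Lemma leastP (P : set nat) :
  match least P with
  | Some n => P n /\ forall k, (k < n)%N -> ~ P k
  | None => forall n, ~ P n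
  end.
Proof.
rewrite /least; case: pselect => [h|h].
  case: ex_minnP => n /asboolP Pn nmin; split=> // k kn Pk.
  by have := nmin k (introT (asboolP _) Pk); rewrite leqNgt kn.
by move=> n Pn; apply: h; exists n; apply/asboolP.
Qed.

(* [pts S] with the first-difference metric, valued in the reals [K]. *)
Definition first_diff_space (K : realType) (S : wA2_space) : Type := pts S.

Section FirstDifferenceMetric.
Local Open Scope ring_scope.
Variables (K : realType) (S : wA2_space).
Local Notation M := (first_diff_space K S).

HB.instance Definition _ := gen_eqMixin M.
HB.instance Definition _ := gen_choiceMixin M.

Definition first_diff_dist (A B : M) : K :=
  if least [set n | restr A n <> restr B n] is Some n then 2 ^- n else 0.

Lemma first_diff_distxx (A : M) : first_diff_dist A A = 0.
Proof.
rewrite /first_diff_dist.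
by case: least (leastP [set n | restr A n <> restr A n]) => // n [].
Qed.

Lemma first_diff_dist_eq0 (A B : M) : first_diff_dist A B = 0 -> A = B.
Proof.
rewrite /first_diff_dist.
case: least (leastP [set n | restr A n <> restr B n]) => [n _ /eqP|eqAB _].
  by rewrite invr_eq0 expf_eq0 pnatr_eq0 andbF.
apply: contrapT => AB.
have [n nAB] := A1_separated (wA2_axiom_A1 (wA2_spaceP S)) AB.
exact: (eqAB n).
Qed.

Lemma first_diff_dist_sym (A B : M) : first_diff_dist A B = first_diff_dist B A.
Proof.
rewrite /first_diff_dist; congr (if least _ is Some n then _ else _).
by apply/seteqP; split=> n /= AB /esym.
Qed.

Lemma first_diff_dist_triangle (B A C : M) :
  first_diff_dist A C <= first_diff_dist A B + first_diff_dist B C.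
Proof.
have ge0 (A' B' : M) : 0 <= first_diff_dist A' B'.
  by rewrite /first_diff_dist; case: least => // n; rewrite invr_ge0 exprn_ge0.
have le2 m n : (m <= n)%N -> 2 ^- n <= 2 ^- m :> K.
  by move=> mn; rewrite lef_pV2 ?posrE ?exprn_gt0// ler_weXn2l// ler1n.
rewrite {1}/first_diff_dist.
case: least (leastP [set n | restr A n <> restr C n]) => [n [/= AC _]|_];
  last first.
  by rewrite addr_ge0.
have [AB|AB] := pselect (restr A n = restr B n).
  have BC : restr B n <> restr C n by rewrite -AB.
  rewrite -[leLHS]add0r lerD// /first_diff_dist.
  case: least (leastP [set k | restr B k <> restr C k]) =>
    [k [_ kmin]|/(_ n)//].
  by rewrite le2// leqNgt; apply/negP => /kmin.
rewrite -[leLHS]addr0 lerD// /first_diff_dist.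
case: least (leastP [set k | restr A k <> restr B k]) => [k [_ kmin]|/(_ n)//].
by rewrite le2// leqNgt; apply/negP => /kmin.
Qed.

HB.instance Definition _ := isMetric.Build K M first_diff_distxx
  first_diff_dist_eq0 first_diff_dist_sym first_diff_dist_triangle.

End FirstDifferenceMetric.

Definition complete_metric (K : realType) (Y : metricType K) : Prop :=
  forall F : set_system Y, ProperFilter F -> cauchy F ->
  exists y : Y, F --> y.

Definition separable (Y : topologicalType) : Prop :=
  exists2 D : set Y, countable D & dense D.

(* [X] is a continuous image of a Polish space (the empty one allowed); only
   the topology of [Y] matters, its metric witnesses complete metrizability. *)
Definition analytic (K : realType) (T : topologicalType) (X : set T) : Prop :=
  exists (Y : metricType K) (f : Y -> T),
    [/\ complete_metric Y, separable Y, continuous f & range f = X].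

(* Main.v *)
(** Unfolding.  Write the analytic set as
    X = { C | exists x, forall k n, T (x|k) (r_n C) }
    and let II, besides her moves in K[a, B], also build x digit by digit: in
    every round she either increments her guess of the next digit or commits to
    it, which she may do only when T allows it.  She wins when she commits
    infinitely often.  This is a Buchi game, decided by a least fixpoint of
    greatest fixpoints, the set [lost] of positions lost for II.
    Outside [lost], II wins the unfolded game, and forgetting the digits gives
    her a strategy for X.
    Inside [lost], I does not see the digits, but after n rounds there are only
    finitely many guess histories; he answers all of them at once by shrinking
    his move successively, as a smaller move of I leaves II fewer answers.  An
    outcome in X would have a witness x, along which one of the simulated runs
    commits infinitely often, against the well-foundedness of [lost].
    Axiom A3 only provides a first B in [a, A]. *)

Require Import Defs.
From mathcomp Require Import all_boot all_order all_algebra.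
From mathcomp Require Import all_classical all_reals all_analysis.
From Stdlib Require List.

Local Open Scope classical_set_scope.

Section Game.
Set Implicit Arguments.
Unset Strict Implicit.
Variable S : wA2_space.
Local Notation R := (pts S).
Local Notation AR := (apx S).

Let A1 := wA2_axiom_A1 (wA2_spaceP S).
Let A2 := wA2_axiom_wA2 (wA2_spaceP S).
Let A3 := wA2_axiom_A3 (wA2_spaceP S).

(** * Elementary facts on basic sets, and limits of coherent approximations *)

Lemma pt_le_refl (A : R) : pt_le A A.
Proof. by case: (pt_le_preorder (wA2_spaceP S)) => + _; apply. Qed.

Lemma pt_le_trans (B A C : R) : pt_le A B -> pt_le B C -> pt_le A C.
Proof. by case: (pt_le_preorder (wA2_spaceP S)) => _; apply. Qed.

Lemma apx_below_le (A B : R) : pt_le A B -> apx_below A `<=` apx_below B.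
Proof.
have [_ fin_trans] := wA2_preorder A2.
move=> /(wA2_le A2) AB a [n an]; have [m nm] := AB n.
by exists m; apply: fin_trans an nm.
Qed.

Lemma basic_trans (a : AR) (A B C : R) :
  pt_le B C -> basic a B A -> basic a C A.
Proof. by move=> BC [AB aA]; split=> //; apply: pt_le_trans AB BC. Qed.

Lemma basic_refl (a : AR) (A B : R) : basic a B A -> basic a A A.
Proof. by move=> [_ aA]; split=> //; apply: pt_le_refl. Qed.

Lemma basic_nonempty (a : AR) (A : R) : apx_below A a -> basic a A !=set0.
Proof.
move=> Aa; have := leastP [set n | fin_le a (restr A n)].
case E : least => [n|] aP; last by case: Aa => n /aP.
apply: (A3_nonempty A3 (B := A) (n := n)) => //.
by split; [exact: pt_le_refl|exists n].
Qed.

Lemma lh_restr (A : R) (n : nat) : lh (restr A n) = n.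
Proof.
rewrite /lh; case: xgetP => [m _ [B _ /(A1_coherent A1)[]]//|/(_ n)[]].
by exists A.
Qed.

(** Points [D n] realizing the [a n] stabilize at every level, so closedness of the space makes
    their limit a point. *)
Lemma outcome_exists (a : nat -> AR) (A : R) (m : nat) :
  restr A m = a 0%N ->
  (forall n, initial_seg (a n) (a n.+1) /\ lh (a n.+1) = (lh (a n)).+1) ->
  exists C, is_outcome (a 0%N) a C.
Proof.
move=> Am aS.
have lha n : lh (a n) = (m + n)%N.
  elim: n => [|n IH]; first by rewrite -Am lh_restr addn0.
  by rewrite (aS n).2 IH addnS.
have /choice[D aD] n : exists D, restr D (m + n) = a n.
  case: n => [|n]; first by exists A; rewrite addn0.
  have [[D [_ [k [_ _ aD]]]] _] := aS n.
  by exists D; rewrite -lha aD lh_restr.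
have DS n k : (k <= m + n)%N -> restr (D n.+1) k = restr (D n) k.
  have [[E [i [j [ij ai aj]]]] _] := aS n.
  have Ei : i = (m + n)%N by rewrite -lha ai lh_restr.
  have Ej : j = (m + n.+1)%N by rewrite -lha aj lh_restr.
  move=> kn.
  have -> : restr (D n.+1) k = restr E k.
    apply: (A1_coherent A1 (n := (m + n.+1)%N) (m := (m + n.+1)%N) _).2.
      by rewrite aD aj Ej.
    by rewrite addnS ltnS.
  move: kn; rewrite leq_eqVlt => /orP[/eqP ->|]; first by rewrite aD ai Ei.
  by apply: (A1_coherent A1 (m := (m + n)%N) _).2; rewrite aD ai Ei.
have DD n i k : (k <= m + n)%N -> restr (D (n + i)%N) k = restr (D n) k.
  move=> kn; elim: i => [|i IH]; first by rewrite addn0.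
  by rewrite addnS DS ?IH// addnA (leq_trans kn)// leq_addr.
pose c : {ptws nat -> discrete_topology {classic AR}} := fun k => restr (D k) k.
have cC : (fun n => approx_seq (D n)) @ \oo --> c.
  apply/pointwise_cvgP => k; apply: cvg_near_cst.
  by exists k => // n /= kn; rewrite -(subnKC kn); apply: DD; exact: leq_addl.
have [C _ Cc] : range (@approx_seq S) c.
  by apply: (closed_cvg _ (pts_closed (wA2_spaceP S)) _ _ cC); exists 0%N.
exists C => n; rewrite -Am lh_restr.
have -> : restr C (m + n) = c (m + n)%N by rewrite -Cc.
by rewrite /c [in D _]addnC DD// aD.
Qed.

(** * The unfolded game and the positions lost for II *)

Variable T : seq nat -> AR -> Prop.

(** II is to move: [played] is I's last move, and [guess] is the current guess for the digit after
    [digits]. *)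
Record position := Position {
  stem : AR; played : R; digits : seq nat; guess : nat }.

(* Well-founded trees serve as ordinal ranks. *)
Inductive tree := Leaf | Node of (position -> tree).

Definition child (t' t : tree) : Prop :=
  if t is Node f then exists q, t' = f q else False.

Definition answers (a : AR) (A : R) (a' : AR) (B : R) : Prop :=
  extensions (lh a).+1 a A a' /\ basic a' A B.

(** I replies knowing which option II took, so his replies to an increment and to a commitment may
    differ. *)
Definition step (Z Q : set position) : set position := [set p |
  forall a B, answers (stem p) (played p) a B ->
  (exists2 A, basic a B A & Q (Position a A (digits p) (guess p).+1)) /\
  (T (rcons (digits p) (guess p)) a ->
   exists2 A, basic a B A & Z (Position a A (rcons (digits p) (guess p)) 0))].

(* I can prevent further commitments, except for one that enters [Z]: the
   greatest fixpoint of [step Z]. *)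
Definition avoids (Z : set position) : set position :=
  [set p | exists2 Q : set position, Q p & Q `<=` step Z Q].

Fixpoint stage (t : tree) : set position :=
  if t is Node f then [set q | avoids (stage (f q)) q] else set0.

Definition lost : set position := [set p | exists t, avoids (stage t) p].

Lemma step_mono (Z Z' Q Q' : set position) :
  Z `<=` Z' -> Q `<=` Q' -> step Z Q `<=` step Z' Q'.
Proof.
move=> ZZ QQ p pZ a B aB; have [[A BA QA] TZ] := pZ a B aB.
split; first by exists A => //; exact: QQ.
by move=> /TZ[A' BA' ZA']; exists A' => //; exact: ZZ.
Qed.

Lemma avoids_mono (Z Z' : set position) : Z `<=` Z' -> avoids Z `<=` avoids Z'.
Proof.
move=> ZZ p [Q Qp QZ]; exists Q => // q /QZ; exact: step_mono.
Qed.

Lemma avoids_step (Z : set position) : avoids Z `<=` step Z (avoids Z).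
Proof.
by move=> p [Q Qp QZ]; apply: step_mono (QZ _ Qp) => // q Qq; exists Q.
Qed.

Lemma step_avoids (Z : set position) : step Z (avoids Z) `<=` avoids Z.
Proof.
move=> p pZ; exists (step Z (avoids Z)) => //.
by apply: step_mono => // q; exact: avoids_step.
Qed.

Lemma answers_le (a a' : AR) (A A' B : R) :
  pt_le A' A -> answers a A' a' B -> answers a A a' B.
Proof.
move=> AA [[a'A aa' la'] a'B]; split; last exact: basic_trans a'B.
by split=> //; exact: apx_below_le a'A.
Qed.

Lemma avoids_le (Z : set position) (a : AR) (A A' : R) (s : seq nat) (j : nat) :
  pt_le A' A -> avoids Z (Position a A s j) -> avoids Z (Position a A' s j).
Proof.
move=> AA /avoids_step pZ; apply: step_avoids => a' B /= aB.
by apply: pZ; exact: answers_le aB.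
Qed.

(** Choosing a rank [f q] for every lost [q] and joining them under [Node f] bounds all ranks at
    once. *)
Lemma avoids_lost : avoids lost `<=` lost.
Proof.
have /choice[f fP] q : exists t, lost q -> avoids (stage t) q.
  by have [[t tq]|nq] := pselect (lost q); [exists t|exists Leaf].
by move=> p pl; exists (Node f); apply: avoids_mono pl => q /fP.
Qed.

(** * I's strategy: simulating all guess histories *)

(* [L] lists the simulated runs as triples (committed digits, current guess,
   rank); they all share the actual moves [a] and [A]. *)
Definition tracked (a : AR) (A : R) (L : seq (seq nat * nat * tree)) : Prop :=
  forall s j t, List.In (s, j, t) L -> avoids (stage t) (Position a A s j).

Definition continues (a : AR) (L L' : seq (seq nat * nat * tree)) : Prop :=
  forall s j t, List.In (s, j, t) L -> List.In (s, j.+1, t) L' /\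
  (T (rcons s j) a -> exists2 t', child t' t & List.In (rcons s j, 0%N, t') L').

Lemma tracked_le (a : AR) (A A' : R) L :
  pt_le A' A -> tracked a A L -> tracked a A' L.
Proof. by move=> AA LA s j t /LA; exact: avoids_le. Qed.

Lemma tracked_cons (a : AR) (A : R) s j t L :
  avoids (stage t) (Position a A s j) -> tracked a A L ->
  tracked a A ((s, j, t) :: L).
Proof. by move=> tA LA s' j' t' /= [[<- <- <-]|/LA]. Qed.

(** Induction on [L]: after a reply serving the tail, the head run costs at most two further
    shrinkings, one for its incremented guess and one for its commitment. *)
Lemma tracked_answer (a a' : AR) (A B : R) L :
  tracked a A L -> answers a A a' B ->
  exists A' L', [/\ basic a' B A', tracked a' A' L' & continues a' L L'].
Proof.
move=> + aB; elim: L => [|[[s j] t] L IH] LA.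
  by exists B, [::]; split=> //; exact: basic_refl aB.2.
have [|A1' [L1 [BA1 LA1 LL1]]] := IH; first by move=> ? ? ? ?; apply: LA; right.
(* [A1'] is treated as if II had played it, so that the next reply lies below it and keeps the tail
   tracked. *)
have aA1 : answers a A a' A1'.
  by split; [exact: aB.1|exact: basic_trans aB.2.1 BA1].
have /avoids_step sA : avoids (stage t) (Position a A s j) by apply: LA; left.
have [[A2' A12 tA2] _] := sA _ _ aA1.
have aA2 : answers a A a' A2'.
  by split; [exact: aB.1|exact: basic_trans aA1.2.1 A12].
have BA2 : basic a' B A2' by exact: basic_trans BA1.1 A12.
have LA2 := tracked_cons tA2 (tracked_le A12.1 LA1).
have [_] := sA _ _ aA2.
have [Tsj /(_ Tsj)[A3' A23 tA3]|nTsj _] := pselect (T (rcons s j) a');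
    last first.
  exists A2', ((s, j.+1, t) :: L1); split => //.
  move=> s' j' t' /= [[<- <- <-]|/LL1[? tL1]]; first by split; [left|].
  by split; [right|move=> /tL1[t'' ? ?]; exists t'' => //; right].
(* A commitment excludes [Leaf], whose [stage] is empty. *)
case: t => [//|f] in LA tA2 LA2 tA3 sA *.
pose t1 := f (Position a' A3' (rcons s j) 0).
exists A3', ((rcons s j, 0%N, t1) :: (s, j.+1, Node f) :: L1); split.
- exact: basic_trans BA2.1 A23.
- by apply: tracked_cons => //; exact: tracked_le A23.1 LA2.
move=> s' j' t' /= [[<- <- <-]|/LL1[? tL1]].
  split; first by right; left.
  by exists t1; [exists (Position a' A3' (rcons s j) 0)|left].
by split; [do 2!right|move=> /tL1[t'' ? ?]; exists t'' => //; do 2!right].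
Qed.

Lemma legal_II_outcome (a : AR) (as_ : nat -> AR) (As Bs : nat -> R) (B : R) :
  (exists n, restr B n = a) -> as_ 0%N = a ->
  (forall n, legal_II as_ As Bs n) -> exists C, is_outcome a as_ C.
Proof.
move=> [m Ba] a0 legal; rewrite -a0.
apply: (outcome_exists (A := B) (m := m)); first by rewrite a0.
by move=> n; have [[_ ? ?] _] := legal n.
Qed.

Lemma I_can_ensure_compl (a : AR) (A B : R) (X : set R) :
  (forall C, X C -> exists x, forall k n, T (mkseq x k) (restr C n)) ->
  basic a B A -> lost (Position a A [::] 0) -> I_can_ensure a B (~` X).
Proof.
move=> XT BA [t0 tA].
pose state := (AR * R * seq (seq nat * nat * tree))%type.
(* With the hypotheses under the existential, choice yields a total function, arbitrary off legal
   play. *)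
have /choice[G GP] (p : state * (AR * R)) : exists p' : state,
    tracked p.1.1.1 p.1.1.2 p.1.2 -> answers p.1.1.1 p.1.1.2 p.2.1 p.2.2 ->
    [/\ p'.1.1 = p.2.1, basic p.2.1 p.2.2 p'.1.2,
        tracked p.2.1 p'.1.2 p'.2 & continues p.2.1 p.1.2 p'.2].
  case: p => [[[a1 A1'] L1] [a2 B2]] /=.
  have [[L1A aB]|n12] := pselect (tracked a1 A1' L1 /\ answers a1 A1' a2 B2).
    by have [A' [L' [? ? ?]]] := tracked_answer L1A aB; exists (a2, A', L').
  by exists (a1, A1', L1) => ? ?; case: n12.
pose st0 : state := (a, A, [:: ([::], 0%N, t0)]).
pose run := foldl (fun st m => G (st, m)) st0.
exists (fun ms => (run ms).1.2) => as_ Bs a0 As.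
pose st n := run (mkseq (fun i => (as_ i.+1, Bs i)) n).
have stS n : st n.+1 = G (st n, (as_ n.+1, Bs n)).
  by rewrite /st mkseqS /run foldl_rcons.
have inv n : (forall i, (i < n)%N -> legal_II as_ As Bs i) ->
    (st n).1.1 = as_ n /\ tracked (as_ n) (As n) (st n).2.
  elim: n => [_|n IH legal].
    by split; [rewrite a0|rewrite a0 /As /=; apply: tracked_cons].
  have [|sn Ln] := IH; first by move=> i ni; exact/legal/ltnW.
  have := GP (st n, (as_ n.+1, Bs n)).
  rewrite /= sn -stS => /(_ Ln (legal n (leqnn _)))[? ? ? ?].
  by split.
have next n : (forall i, (i < n.+1)%N -> legal_II as_ As Bs i) ->
    basic (as_ n.+1) (Bs n) (As n.+1) /\
    continues (as_ n.+1) (st n).2 (st n.+1).2.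
  move=> legal; have [|sn Ln] := inv n; first by move=> i ni; exact/legal/ltnW.
  have := GP (st n, (as_ n.+1, Bs n)).
  by rewrite /= sn -stS => /(_ Ln (legal n (leqnn _)))[? ? ? ?].
split.
  case=> [_|n legal]; last by have [] := next _ legal.
  by rewrite /legal_I a0.
move=> legal.
have [C aC] := legal_II_outcome BA.2 a0 legal.
exists C => // /XT[x xC].
(* A run that has committed the first [k] digits of [x] is kept until its guess reaches the true
   digit [x k]. *)
have wait k t n i : (i <= x k)%N -> List.In (mkseq x k, 0%N, t) (st n).2 ->
    List.In (mkseq x k, i, t) (st (n + i)%N).2.
  elim: i => [|i IH] ix kt; first by rewrite addn0.
  rewrite addnS; have [_ nx] := next (n + i)%N (fun i _ => legal i).
  by have [] := nx _ _ _ (IH (ltnW ix) kt).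
(* Induction on the rank: at guess [x k] the relation [T] allows the commitment, which passes to a
   child of [t]. *)
have nocand t : forall k n, ~ List.In (mkseq x k, 0%N, t) (st n).2.
  elim: t => [|f IH] k n /(wait _ _ _ _ (leqnn _)) kt;
    have [_ nx] := next (n + x k)%N (fun i _ => legal i);
    have [_] := nx _ _ _ kt; rewrite -aC -mkseqS => /(_ (xC _ _))[] //.
  by move=> _ [q ->]; exact: IH.
by apply: (nocand t0 0%N 0%N); left.
Qed.

(** * II's strategy outside the lost positions *)

(* II can force a further commitment, to a position that is not [lost]. *)
Fixpoint attracts (t : tree) : set position :=
  if t is Node f then [set p | exists a B, answers (stem p) (played p) a B /\
    ((forall A, basic a B A -> let q := Position a A (digits p) (guess p).+1 in
        attracts (f q) q) \/
     (T (rcons (digits p) (guess p)) a /\ forall A, basic a B A ->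
        ~ lost (Position a A (rcons (digits p) (guess p)) 0)))]
  else set0.

(** Positions without an attracting tree form a post-fixed point of [step lost], hence are lost by
    [avoids_lost]. *)
Lemma attracts_not_lost (p : position) : ~ lost p -> exists t, attracts t p.
Proof.
move=> np; apply: contrapT => nt; apply/np/avoids_lost.
exists [set q | ~ exists t, attracts t q] => // q /= nq a B aB.
have /choice[f fP] p' : exists t, (exists t', attracts t' p') -> attracts t p'.
  by have [[t tp]|] := pselect (exists t', attracts t' p');
    [exists t|exists Leaf].
split; apply: contrapT => nA; apply: nq; exists (Node f), a, B; split => //.
  left=> A BA q'; apply: fP; apply: contrapT => nq'; apply: nA.
  by exists A.
have [Tq TA] : T (rcons (digits q) (guess q)) a /\ ~ exists2 A, basic a B A &
    lost (Position a A (rcons (digits q) (guess q)) 0).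
  by split; [apply: contrapT => nT|move=> ?]; apply: nA.
by right; split=> // A BA lA; apply: TA; exists A.
Qed.

(* [prev] is II's last move; [rank], consulted once I has moved, makes the wait
   for the next digit well-founded. *)
Record state := State {
  cur : AR; prev : R; word : seq nat; count : nat; rank : position -> tree }.

Definition promising (z : state) : Prop := forall A, basic (cur z) (prev z) A ->
  let p := Position (cur z) A (word z) (count z) in attracts (rank z p) p.

(** In the waiting case [rank z'] is the family of subtrees of the rank just consulted, so waiting
    descends. *)
Definition progress (z : state) (A : R) (z' : state) : Prop :=
  (rank z (Position (cur z) A (word z) (count z)) = Node (rank z') /\
   word z' = word z) \/
  (word z' = rcons (word z) (count z) /\ T (word z') (cur z')).

Lemma not_lost_promising (a : AR) (B : R) (s : seq nat) (j : nat) :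
  (forall A, basic a B A -> ~ lost (Position a A s j)) ->
  exists f, promising (State a B s j f).
Proof.
move=> nl.
have /choice[f fP] p : exists t, ~ lost p -> attracts t p.
  have [l|/attracts_not_lost[t tp]] := pselect (lost p); last by exists t.
  by exists Leaf.
by exists f => A /nl; exact: fP.
Qed.

Lemma promising_next (z : state) (A : R) :
  promising z -> basic (cur z) (prev z) A ->
  exists z', [/\ promising z', answers (cur z) A (cur z') (prev z') &
    progress z A z'].
Proof.
move=> pz zA; have /= := pz A zA.
case E : rank => [//|f] /= [a [B [aB [fB|[Tz /not_lost_promising[g gB]]]]]].
  exists (State a B (word z) (count z).+1 f); split=> //.
  by left; split.
by exists (State a B (rcons (word z) (count z)) 0 g); split=> //; right.
Qed.

Lemma II_can_ensure_of_not_lost (a : AR) (B : R) (X : set R) :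
  (forall x C,
     (forall k, exists2 n, (k <= n)%N & T (mkseq x k.+1) (restr C n)) ->
     X C) ->
  (exists n, restr B n = a) ->
  (forall A, basic a B A -> ~ lost (Position a A [::] 0)) ->
  II_can_ensure a B X.
Proof.
move=> TX Ba /not_lost_promising[f0 f0P].
have /choice[G GP] (p : state * R) : exists z', promising p.1 ->
    basic (cur p.1) (prev p.1) p.2 ->
    [/\ promising z', answers (cur p.1) p.2 (cur z') (prev z') &
      progress p.1 p.2 z'].
  case: p => z A /=.
  have [[pz zA]|nz] := pselect (promising z /\ basic (cur z) (prev z) A).
    by have [z' ?] := promising_next pz zA; exists z'.
  by exists z => ? ?; case: nz.
pose run := foldl (fun z A => G (z, A)) (State a B [::] 0 f0).
exists (fun ms => (cur (run ms), prev (run ms))) => As as_ Bs.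
pose z n := run (mkseq As n).
have zS n : z n.+1 = G (z n, As n) by rewrite /z mkseqS /run foldl_rcons.
have zas n : as_ n = cur (z n) by case: n.
have zBs n : previous B Bs n = prev (z n) by case: n.
have inv n : (forall i, (i < n)%N -> legal_I B as_ As Bs i) -> promising (z n).
  elim: n => [//|n IH] legal; have := GP (z n, As n).
  rewrite -zS /= -zas -zBs; case=> //; last exact: legal.
  by apply: IH => i ni; exact/legal/ltnW.
have next n : (forall i, (i <= n)%N -> legal_I B as_ As Bs i) ->
    answers (as_ n) (As n) (as_ n.+1) (Bs n) /\ progress (z n) (As n) (z n.+1).
  move=> legal; have := GP (z n, As n).
  rewrite -zS /= -zas -zBs; case=> //; last exact: legal.
  by apply: inv => i ni; exact/legal/ltnW.
split; first by move=> n /next[].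
move=> legal.
have nextL n := next n (fun i _ => legal i).
have [C aC] := legal_II_outcome Ba (erefl _) (fun n => (nextL n).1).
exists C => //.
(* The first commitment after round [n] adds the digit [mj.2] and leads to state [mj.1]; it exists
   by induction on the rank. *)
have /choice[mj mjP] n : exists mj, [/\ (n < mj.1)%N,
    word (z mj.1) = rcons (word (z n)) mj.2 & T (word (z mj.1)) (as_ mj.1)].
  pose posn i := Position (cur (z i)) (As i) (word (z i)) (count (z i)).
  have [t] : exists t, t = rank (z n) (posn n) by eexists.
  elim: t n => [|f IH] n; have [_ [[-> ww]|[ww Tz]]] := nextL n; first by [].
  - by move=> _; exists (n.+1, count (z n)); rewrite zas.
  - move=> [fr].
    have [|[m j] [nm wm Tm]] := IH (posn n.+1) n.+1; first by rewrite fr.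
    by exists (m, j); split=> //; [exact: ltnW|rewrite wm ww].
  - by move=> _; exists (n.+1, count (z n)); rewrite zas.
(* In state [m k] exactly [k] digits are committed, so [k <= m k]. *)
pose m k := iter k (fun n => (mj n).1) 0%N.
pose x k := (mj (m k)).2.
have km k : (k <= m k)%N.
  by elim: k => // k IH; have [+ _ _] := mjP (m k); exact: leq_ltn_trans.
have wx k : word (z (m k)) = mkseq x k.
  by elim: k => // k IH; rewrite mkseqS -IH; have [] := mjP (m k).
apply: (TX x) => k; exists (lh a + m k.+1)%N.
  by rewrite (leq_trans (ltnW (km k.+1)))// leq_addl.
by rewrite aC -wx; have [] := mjP (m k).
Qed.

(** The case split is on whether I has a lost opening. Against I's strategy [T] must hold at all
    pairs, since simulated commitments come at uncontrolled rounds; II checks each prefix only once,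
    at a late round. *)
Lemma unfolding_kastanas_ramsey (X : set R) :
  (forall C, X C -> exists x, forall k n, T (mkseq x k) (restr C n)) ->
  (forall x C,
     (forall k, exists2 n, (k <= n)%N & T (mkseq x k.+1) (restr C n)) ->
     X C) ->
  kastanas_ramsey X.
Proof.
move=> XT TX A a /basic_nonempty[B AB]; exists B => //.
have [[A' BA' lA']|nl] :=
    pselect (exists2 A', basic a B A' & lost (Position a A' [::] 0)).
  by left; exact: I_can_ensure_compl BA' lA'.
right; apply: II_can_ensure_of_not_lost => //; first exact: AB.2.
by move=> A' BA' lA'; apply: nl; exists A'.
Qed.

End Game.

(** * Analytic sets as projections of a relation on digits and approximations *)

Section Scheme.
Set Implicit Arguments.
Unset Strict Implicit.
Import Order.TTheory GRing.Theory Num.Theory.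
Import numFieldNormedType.Exports.
Local Open Scope ring_scope.
Variables (K : realType) (S : wA2_space).
Local Notation M := (first_diff_space K S).

Lemma small_power (e : K) : 0 < e -> exists i : nat, 2 ^- i < e.
Proof.
move=> e0.
have /cvgrPdist_lt/(_ _ e0)[i _ /(_ i (leqnn i))] :
    (fun i : nat => 2 ^- i : K) @ \oo --> (0 : K).
  under eq_fun do rewrite -exprVn.
  by apply: cvg_expr; rewrite ger0_norm ?invf_lt1 ?ltr1n.
by rewrite sub0r normrN ger0_norm ?invr_ge0 ?exprn_ge0//; exists i.
Qed.

Lemma first_diff_dist_lt (A B : M) (n : nat) :
  first_diff_dist A B < 2 ^- n -> restr A n = restr B n.
Proof.
rewrite /first_diff_dist.
case: least (leastP [set k | restr A k <> restr B k]) => [k [ABk kmin]|nAB] lt.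
  apply: contrapT => /kmin; apply; rewrite ltnNge; apply/negP => kn.
  by move: lt; rewrite ltNge lef_pV2 ?posrE ?exprn_gt0// ler_weXn2l// ler1n.
by apply: contrapT => /nAB.
Qed.

Lemma first_diff_cvg_eq (u : nat -> M) (A B : M) (N : nat -> nat) :
  (forall k, (k <= N k)%N /\ restr (u k) (N k) = restr A (N k)) ->
  u @ \oo --> B -> A = B.
Proof.
have A1 := wA2_axiom_A1 (wA2_spaceP S).
move=> uA uB; apply: contrapT => /(A1_separated A1)[n].
apply; have : \forall k \near \oo, ball B (2 ^- n) (u k).
  by apply: uB; apply: nbhsx_ballx; rewrite invr_gt0 exprn_gt0.
move=> [m _ um].
have /um /= : (m <= maxn m n)%N by rewrite leq_maxl.
rewrite ballEmdist /= => /first_diff_dist_lt ->.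
set k := maxn m n; have [kN uAk] := uA k.
have nN : (n <= N k)%N by rewrite (leq_trans _ kN)// leq_maxr.
move: nN; rewrite leq_eqVlt => /orP[/eqP ->//|nN].
by have [_ ->] := A1_coherent A1 uAk.
Qed.

Lemma analytic_kastanas_ramsey (X : set M) :
  analytic K X -> kastanas_ramsey (S := S) X.
Proof.
move=> [Y [f [Ycomplete [D /countable_injP[g gD] Ddense] fcont fX]]].
(* A digit is the [g]-code of a point of the dense set [D]; the [i]-th one locates [y] within
   [2 ^- i]. *)
pose near_code i (c : nat) (y : Y) :=
  exists z, [/\ D z, g z = c & ball z (2 ^- i) y].
pose scheme (s : seq nat) (y : Y) :=
  forall i, (i < size s)%N -> near_code i (nth 0%N s i) y.
pose T (s : seq nat) (b : apx S) :=
  exists2 y, scheme s y & exists n, restr (f y : pts S) n = b.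
apply: (@unfolding_kastanas_ramsey S T).
  move=> C; rewrite -fX => -[y _ <-].
  have /choice[x xP] i : exists c, near_code i c y.
    have [z [/interior_subset yz Dz]] : (ball y (2 ^- i))^° `&` D !=set0.
      apply: Ddense; last exact: open_interior.
      by exists y; apply: nbhsx_ballx; rewrite invr_gt0 exprn_gt0.
    by exists (g z), z; split=> //; exact: ball_sym.
  exists x => k n; exists y; last by exists n.
  by move=> i; rewrite size_mkseq => ik; rewrite nth_mkseq.
move=> x C xC.
have /choice[yN yNP] k : exists yN : Y * nat, [/\ scheme (mkseq x k.+1) yN.1,
    (k <= yN.2)%N & restr (f yN.1 : pts S) yN.2 = restr C yN.2].
  have [n kn [y ys [m yn]]] := xC k; exists (y, n); split=> //=.
  (* [T] leaves the index of the approximation of [f y] free; A1 forces it to be [n]. *)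
  by rewrite -yn; have [->] := A1_coherent (wA2_axiom_A1 (wA2_spaceP S)) yn.
pose y k := (yN k).1.
have ynear i k : (i <= k)%N -> near_code i (x i) (y k).
  move=> ik; have [/(_ i) + _ _] := yNP k.
  by rewrite size_mkseq ltnS => /(_ ik); rewrite nth_mkseq.
(* As [g] is injective on [D], the digit [x i] gives one centre within [2 ^- i] of all [y k] with
   [i <= k]. *)
have : cauchy (y @ \oo).
  apply: cauchy_exP => e e0.
  have [i ie] := small_power e0.
  have [z [Dz gz _]] := ynear i i (leqnn i).
  exists z; exists i => // k /= ik.
  have [z' [Dz' gz' yk]] := ynear i k ik.
  have -> : z = z' by apply: gD; rewrite ?inE ?gz ?gz'.
  by apply: le_ball yk; exact: ltW.
move=> /Ycomplete[l yl].
rewrite -fX; exists l => //; apply/esym.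
apply: (@first_diff_cvg_eq (f \o y) C (f l) (fun k => (yN k).2)).
  by move=> k; have [] := yNP k.
by apply: cvg_comp yl _; exact: fcont.
Qed.

End Scheme.

Theorem theorem1p2 (K : realType) (S : wA2_space)
    (X : set (first_diff_space K S)) :
  countable [set: apx S] -> analytic K X -> kastanas_ramsey (S := S) X.
Proof. by move=> _; exact: analytic_kastanas_ramsey. Qed.
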